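(* Let $q>3$ and let $f(x)\in\mathbb{F}_{q^n}[x]$ be a scattered polynomial such that $L_f$ is not of pseudoregulus type. Then the translation plane $\mathcal{A}_f$ is not a generalized André plane.
   Context: $q$ is a prime power, $n>1$. A $q$-polynomial $f(x)=\sum_{i=0}^{n-1}a_ix^{q^i}\in\mathbb{F}_{q^n}[x]$ is scattered if for all $y,z\in\mathbb{F}_{q^n}$, $zf(y)-yf(z)=0$ implies $y,z$ are $\mathbb{F}_q$-linearly dependent. $U_f=\{(x,f(x))\colon x\in\mathbb{F}_{q^n}\}$, $L_f=\{\langle(x,f(x))\rangle_{\mathbb{F}_{q^n}}\colon x\ne0\}\subseteq\mathrm{PG}(1,q^n)$. $L_f$ is of pseudoregulus type if there exist $\varphi\in\mathrm{GL}(2,q^n)$ and $s$ with $\gcd(s,n)=1$ such that $\varphi$ maps $L_f$ onto $\{\langle(x,x^{q^s})\rangle_{\mathbb{F}_{q^n}}\colon x\ne0\}$. With $\mathcal{D}=\{\langle v\rangle_{\mathbb{F}_{q^n}}\colon v\ne0\}$, the set $\mathcal{B}_f=(\mathcal{D}\setminus L_f)\cup\{hU_f\colon h\in\mathbb{F}_{q^n}^*\}$ is a spread of $\mathbb{F}_{q^n}^2$ (as $2n$-dimensional $\mathbb{F}_q$-space), and $\mathcal{A}_f$ is the translation plane whose points are vectors of $\mathbb{F}_{q^n}^2$ and whose lines are the cosets $v+W$, $W\in\mathcal{B}_f$. A generalized André plane is a translation plane coordinatized by a generalized André system, i.e. a quasifield $(F,+,\circ)$ with $F$ a finite field, $x\circ0=0$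 and $x\circ y=x^{\lambda(y)}y$ for $y\neq0$, where $\lambda\colon F^*\to\mathrm{Aut}(F)$ satisfies $\lambda(1)=\mathrm{id}$. *)

(* Defs.v *)
From HB Require Import structures.
From mathcomp Require Import all_boot all_order all_algebra.
Set Implicit Arguments. Unset Strict Implicit. Unset Printing Implicit Defensive.
Import GRing.Theory.
Local Open Scope ring_scope.

Section Defs.
Variable L : finFieldType.

Definition q_polynomial (q n : nat) (a : 'I_n -> L) : L -> L :=
  fun x => \sum_(i < n) a i * x ^+ (q ^ i)%N.

Definition inFq (q : nat) (x : L) : Prop := x ^+ q = x.

Definition Fq_dep (q : nat) (y z : L) : Prop :=
  exists l m : L, inFq q l /\ inFq q m /\ (l != 0 \/ m != 0) /\ l * y + m * z = 0.

Definition scattered (q : nat) (f : L -> L) : Prop :=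
  forall y z : L, z * f y - y * f z = 0 -> Fq_dep q y z.

(* the (nonzero) vector v spans a point of L_f = {<(x, f x)> : x <> 0} *)
Definition in_Lf (f : L -> L) (v : L * L) : Prop :=
  exists x : L, x != 0 /\ exists c : L, v = (c * x, c * f x).

(* L_f is of pseudoregulus type: some phi in GL(2,q^n) (matrix [[a b];[c d]])
   maps L_f onto {<(x, x^{q^s})> : x <> 0} with gcd(s,n) = 1 *)
Definition pseudoregulus (q n : nat) (f : L -> L) : Prop :=
  exists (a b c d : L) (s : nat),
    a * d - b * c != 0 /\ coprime s n /\
    forall v : L * L, v != (0, 0) ->
      (in_Lf f v <-> in_Lf (fun x => x ^+ (q ^ s)%N) (a * v.1 + b * v.2, c * v.1 + d * v.2)).

(* W (an F_q-subspace of L^2, as a point set) belongs to the spread B_f *)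
Definition in_Bf (f : L -> L) (W : L * L -> Prop) : Prop :=
  (exists u : L * L, u != (0, 0) /\ ~ in_Lf f u /\
     forall w, W w <-> exists c : L, w = (c * u.1, c * u.2))
  \/ (exists h : L, h != 0 /\ forall w, W w <-> exists x : L, w = (h * x, h * f x)).

Definition Af_line (f : L -> L) (S : L * L -> Prop) : Prop :=
  exists (v : L * L) (W : L * L -> Prop), in_Bf f W /\
    forall p, S p <-> exists w, W w /\ p = (v.1 + w.1, v.2 + w.2).
End Defs.

Section Andre.
Variable F : finFieldType.

Definition gas_op (lam : F -> F -> F) (x y : F) : F :=
  if y == 0 then 0 else lam y x * y.

Definition gas_map (lam : F -> F -> F) : Prop :=
  (forall y, y != 0 ->
     [/\ forall x1 x2, lam y (x1 + x2) = lam y x1 + lam y x2,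
         forall x1 x2, lam y (x1 * x2) = lam y x1 * lam y x2,
         lam y 1 = 1 & bijective (lam y)]) /\
  (forall x, lam 1 x = x).

Definition is_quasifield (op : F -> F -> F) : Prop :=
  [/\ forall x, op x 0 = 0 /\ op 0 x = 0,
      forall x, op 1 x = x /\ op x 1 = x,
      forall x y z, op (x + y) z = op x z + op y z,
      forall a b, a != 0 -> exists! x, op a x = b &
      forall a b c, a != b -> exists! x, op x a = op x b + c].

Definition qf_line (op : F -> F -> F) (S : F * F -> Prop) : Prop :=
  (exists m b : F, forall p, S p <-> p.2 = op p.1 m + b)
  \/ (exists c : F, forall p, S p <-> p.1 = c).
End Andre.

Definition iso_planes (P1 P2 : Type) (line1 : (P1 -> Prop) -> Prop)
  (line2 : (P2 -> Prop) -> Prop) : Prop :=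
  exists sigma : P1 -> P2, bijective sigma /\
    forall S : P1 -> Prop, line1 S <-> line2 (fun y => exists x, S x /\ sigma x = y).

Definition gen_andre_plane (P : Type) (line : (P -> Prop) -> Prop) : Prop :=
  exists (F : finFieldType) (lam : F -> F -> F),
    gas_map lam /\ is_quasifield (gas_op lam) /\ iso_planes line (qf_line (gas_op lam)).

(* Main.v *)
Require Import Defs.
From HB Require Import structures.
From mathcomp Require Import all_boot all_order all_algebra.
From mathcomp Require Import fingroup cyclic finfield zify ring.
From Stdlib Require Import Classical_Prop.
Set Implicit Arguments. Unset Strict Implicit. Unset Printing Implicit Defensive.
Import GRing.Theory.
Local Open Scope ring_scope.

(** In an isomorphism onto a generalized André plane, which may be taken
    additive, the components are V(m) = {(x, x^λ(m) m)} and the two axes.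
    At most a third of the V(m) come from the hU_f, so the others come from
    points of PG(1, q^n).  As F has at most log_2 |F| automorphisms, some
    automorphism i is λ(m) for more than 1 + sqrt |F| of these others; these
    V(m) are lines of the Desarguesian spread {y = x^i m}.  Two Desarguesian
    spreads sharing three components share a subfield worth of them, so they
    coincide: the isomorphism is semilinear up to (x, y) -> (x^i, y).  Reading
    U_f as some V(m) in these coordinates gives U_f = {z P + z^φ R} with φ an
    automorphism, that is, L_f is of pseudoregulus type.  The counting needs
    n > 3; for n = 2, 3 every scattered polynomial is of pseudoregulus type. *)

(** * Finite fields: fixed fields, Frobenius maps and large subrings *)

Section FiniteFields.
Variable L : finFieldType.

Lemma card_roots_le (P : {poly L}) (A : {set L}) :
  P != 0 -> (forall x, x \in A -> root P x) -> (#|A| < size P)%N.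
Proof.
move=> P0 rA; rewrite cardE; apply: max_poly_roots (enum_uniq A) => //.
by apply/allP => x; rewrite mem_enum; apply: rA.
Qed.

Lemma card_expf_scale_le (q : nat) (d : L) (A : {set L}) :
  (1 < q)%N -> (forall x, x \in A -> x ^+ q = d * x) -> (#|A| <= q)%N.
Proof.
move=> q1 hA.
have sP : size ('X^q - d *: 'X : {poly L}) = q.+1.
  rewrite size_polyDl ?size_polyXn // size_polyN.
  by apply: leq_ltn_trans (size_scale_leq _ _) _; rewrite size_polyX.
rewrite -ltnS -sP; apply: card_roots_le => [|x xA].
  by rewrite -size_poly_eq0 sP.
by rewrite /root !hornerE hA // subrr.
Qed.

Lemma finField_generator :
  exists2 z : L, z != 0 & forall x : L, x != 0 -> exists e, x = z ^+ e.
Proof.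
have /cyclicP[u eu] := field_unit_group_cyclic [set: {unit L}]%G.
exists (val u) => [|x x0]; first by rewrite -unitfE; apply: (valP u).
have Ux : x \is a GRing.unit by rewrite unitfE.
have : FinRing.unit L Ux \in <[u]>%g by rewrite -eu inE.
case/cycleP=> e /(congr1 val) /= ->; exists e.
by rewrite FinRing.val_unitX.
Qed.

(** The upper bound counts roots of X^q - X. For the lower one, q - 1 divides q^n - 1, so the cyclic
    unit group has a subgroup of order q - 1, whose elements are fixed, as is 0. *)
Lemma card_Fq (q n : nat) :
  (1 < q)%N -> (0 < n)%N -> #|L| = (q ^ n)%N ->
  #|[set x : L | x ^+ q == x]| = q.
Proof.
move=> q1 n0 cL; apply/eqP; rewrite eqn_leq; apply/andP; split.
  apply: (@card_expf_scale_le q 1) => // x.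
  by rewrite inE mul1r => /eqP.
have /cyclicP[u eu] := field_unit_group_cyclic [set: {unit L}]%G.
have ou : #[u]%g = (q ^ n).-1 by rewrite /order -eu card_finField_unit cL.
have [m em] : exists m, (q ^ n).-1 = (m * q.-1)%N.
  by apply/dvdnP; rewrite -!subn1 -[X in (_ %| _ - X)%N](exp1n n) subn_exp dvdn_mulr.
have m0 : (0 < m)%N.
  rewrite lt0n; apply/eqP => m0; move: em; rewrite m0 mul0n => e.
  by have := ltn_exp2l 0 n q1; rewrite n0 expn0; lia.
have ob : #[u ^+ m]%g = q.-1.
  by rewrite orderXdiv ou em ?dvdn_mulr // mulKn.
have sub : 0 |: [set val w | w in <[u ^+ m]>%g] \subset [set x : L | x ^+ q == x].
  apply/subsetP => x; rewrite !inE => /orP[/eqP->|/imsetP[w wb ->]].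
    by rewrite expr0n; case: (q) q1.
  have : (w ^+ q = w)%g.
    rewrite -(prednK (ltnW q1)) expgS -ob.
    have /eqP -> : (w ^+ #[(u ^+ m)] == 1)%g by rewrite -order_dvdn order_dvdG.
    by rewrite mulg1.
  by move/(congr1 val); rewrite FinRing.val_unitX => ->.
apply: leq_trans (subset_leq_card sub).
rewrite cardsU1 card_imset -/(order _) ?ob; last exact: val_inj.
have -> : 0 \notin [set val w | w in <[u ^+ m]>%g].
  apply/imsetP => -[w _ /esym /eqP]; apply/negP.
  by rewrite -unitfE; apply: (valP w).
by rewrite add1n prednK // ltnW.
Qed.

(** The images of 0, ..., p - 1 are p distinct roots of X^p - X, which has no others. *)
Lemma prime_subfield (p : nat) (x : L) :
  p \in [pchar L] -> x ^+ p = x -> exists m, x = m%:R.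
Proof.
move=> pL xp; have pp := pcharf_prime pL.
pose S := [set (val i)%:R | i : 'I_p] : {set L}.
pose T := [set y : L | y ^+ p == y].
have ST : S \subset T.
  apply/subsetP => y /imsetP[i _ ->]; rewrite inE.
  by rewrite -(pFrobenius_autE pL) pFrobenius_aut_nat.
have cS : #|S| = p.
  rewrite card_in_imset ?card_ord // => i j _ _ /eqP /=.
  wlog ij : i j / (i <= j)%N => [hw|].
    by case: (leqP i j) => [/hw//|/ltnW /hw h]; rewrite eq_sym => /h.
  rewrite eq_sym -subr_eq0 -natrB // -(dvdn_pcharf pL) => d.
  apply/val_inj => /=; case: (posnP (j - i)) => [|h]; first by lia.
  by have := dvdn_leq h d; have := ltn_ord j; lia.
have /eqP E : S == T.
  rewrite eqEcard ST cS (@card_expf_scale_le p 1) ?prime_gt1 // => y.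
  by rewrite inE mul1r => /eqP.
have : x \in T by rewrite inE xp.
by rewrite -E => /imsetP[i _ ->]; exists i.
Qed.

Lemma pchar_nat_expn (p k n m : nat) :
  prime p -> #|L| = ((p ^ k) ^ n)%N -> [pchar L].-nat ((p ^ k) ^ m)%N.
Proof.
move=> pp; rewrite -expnM => cL; have pL := card_finPcharP cL pp.
apply: (@sub_in_pnat p); last by rewrite -expnM pnatX pnat_id.
by move=> r _; rewrite inE => /eqP->.
Qed.

Lemma exists_frobenius (m : nat) :
  [pchar L].-nat m -> exists F : {rmorphism L -> L}, forall x, F x = x ^+ m.
Proof.
move=> charm; pose Fr (x : L) := x ^+ m.
have FrD : zmod_morphism Fr.
  by move=> x y; rewrite /Fr exprDn_pchar // exprNn_pchar.
have FrM : monoid_morphism Fr.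
  by split=> [|x y]; rewrite /Fr ?expr1n // exprMn.
pose FrDM := GRing.isZmodMorphism.Build L L Fr FrD.
pose FrMM := GRing.isMonoidMorphism.Build L L Fr FrM.
by exists (HB.pack Fr FrDM FrMM : {rmorphism L -> L}).
Qed.

(** For a generator z of the units, x -> x^q permutes the factors X - z^(q^j) of [P], so the
    coefficients of [P] are fixed by it and hence by [f]. Thus f z is again a root z^(q^s) of [P],
    and f is determined by f z. *)
Lemma rmorph_frobenius (p k n : nat) (f : {rmorphism L -> L}) :
  prime p -> (0 < n)%N -> #|L| = ((p ^ k) ^ n)%N ->
  (forall x, x ^+ (p ^ k) = x -> f x = x) ->
  exists2 s, (s < n)%N & forall x, f x = x ^+ ((p ^ k) ^ s).
Proof.
set q := (p ^ k)%N => pp n0 cL fixf.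
have [z z0 zgen] := finField_generator.
have charq : [pchar L].-nat q by have := pchar_nat_expn 1 pp cL; rewrite expn1.
have [F FE] := exists_frobenius charq.
pose G j : {poly L} := 'X - (z ^+ (q ^ j))%:P.
pose P := \prod_(0 <= j < n) G j.
have FP : map_poly F P = P.
  rewrite /P map_prod_XsubC.
  under eq_bigr => j _ do rewrite FE -exprM -expnSr -/(G j.+1).
  (* The factors shift by one place; the last becomes the first because z^(q^n) = z. *)
  rewrite -(prednK n0) big_nat_recr // [RHS]big_nat_recl //= mulrC; congr (_ * _).
  by rewrite /G (prednK n0) -cL expf_card expn0 expr1.
have fP : map_poly f P = P.
  apply/polyP => i; rewrite coef_map; apply: fixf.
  by rewrite -[in RHS]FP coef_map /= FE.
have rz : root P z.
  by rewrite /P -(prednK n0) big_nat_recl // rootM /G expn0 expr1 root_XsubC eqxx.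
have := rmorph_root f rz; rewrite fP rootE horner_prod prodf_seq_eq0 => /hasP /=[s].
rewrite mem_index_iota /G !hornerE subr_eq0 => sn /eqP fz.
exists s => // x; have [->|/zgen[e ->]] := eqVneq x 0.
  by rewrite rmorph0 expr0n expn_eq0; case: (q) (charq).
by rewrite rmorphXn fz -!exprM mulnC.
Qed.

(** Inverses are powers, x^-1 = x^(|L| - 2), so [K] is a subfield; an element y outside it would
    make a + b y injective on pairs from [K], giving |K|^2 <= |L|. *)
Lemma subring_full (K : {set L}) :
  1 \in K -> {in K &, forall x y, x - y \in K} -> {in K &, forall x y, x * y \in K} ->
  (#|L| < #|K| ^ 2)%N -> forall x, x \in K.
Proof.
move=> K1 KB KM cK y; apply: contraLR cK => yK; rewrite -leqNgt.
have K0 : 0 \in K by rewrite -(subrr 1) KB.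
have KX x m : x \in K -> x ^+ m \in K.
  by move=> xK; elim: m => [|m IH]; rewrite ?expr0 // exprS KM.
have KV x : x \in K -> x^-1 \in K.
  have [-> _|x0 xK] := eqVneq x 0; first by rewrite invr0.
  suff -> : x^-1 = x ^+ (#|L| - 2) by apply: KX.
  apply: (mulfI x0); rewrite divff //; apply: (mulfI x0).
  rewrite -2!exprS mulr1 -[LHS]expf_card; congr (_ ^+ _).
  by move: (finNzRing_gt1 L); case: #|L| => [|[|m]] // _; rewrite subn2.
rewrite -mulnn -cardsX -cardsT.
pose g (u : L * L) := u.1 + u.2 * y.
rewrite -(@card_in_imset _ _ g) ?subset_leq_card ?subsetT //.
move=> [a b] [c d]; rewrite !inE /= /g /= => /andP[aK bK] /andP[cK dK] E.
have E' : (b - d) * y = c - a.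
  have -> : c = a + b * y - d * y by rewrite E addrK.
  by ring.
have [bd|bd] := eqVneq (b - d) 0.
  move: E' => /eqP; rewrite bd mul0r eq_sym subr_eq0 => /eqP->.
  by move/eqP: bd; rewrite subr_eq0 => /eqP->.
case/negP: yK; suff -> : y = (b - d)^-1 * (c - a) by rewrite KM ?KV ?KB.
by rewrite -E' mulKf.
Qed.

End FiniteFields.

Lemma det2_inj (R : idomainType) (a b c d x y x' y' : R) :
  a * d - b * c != 0 -> a * x + b * y = a * x' + b * y' ->
  c * x + d * y = c * x' + d * y' -> x = x' /\ y = y'.
Proof.
move=> D0 e1 e2; split; apply: (mulfI D0).
  have -> : (a * d - b * c) * x = d * (a * x + b * y) - b * (c * x + d * y) by ring.
  by rewrite e1 e2; ring.
have -> : (a * d - b * c) * y = a * (c * x + d * y) - c * (a * x + b * y) by ring.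
by rewrite e1 e2; ring.
Qed.

(** * Scattered polynomials and pseudoregulus type *)

Section Scattered.
Variables (L : finFieldType) (p k n : nat).
Let q := (p ^ k)%N.
Hypotheses (pp : prime p) (q1 : (1 < q)%N) (n1 : (1 < n)%N).
Hypothesis cL : #|L| = (q ^ n)%N.

Let charq i : [pchar L].-nat (q ^ i)%N := pchar_nat_expn i pp cL.

Lemma q_polynomialD (a : 'I_n -> L) x y :
  q_polynomial q a (x + y) = q_polynomial q a x + q_polynomial q a y.
Proof.
rewrite /q_polynomial -big_split; apply: eq_bigr => i _ /=.
by rewrite exprDn_pchar // mulrDr.
Qed.

Lemma inFq_exp i (c : L) : inFq q c -> c ^+ (q ^ i) = c.
Proof.
move=> hc; elim: i => [|i IH]; first by rewrite expn0 expr1.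
by rewrite expnS exprM hc.
Qed.

Lemma q_polynomialZ (a : 'I_n -> L) c x :
  inFq q c -> q_polynomial q a (c * x) = c * q_polynomial q a x.
Proof.
move=> hc; rewrite /q_polynomial mulr_sumr; apply: eq_bigr => i _ /=.
by rewrite exprMn (inFq_exp i hc) mulrCA.
Qed.

Variable f : L -> L.
Hypothesis fD : forall x y, f (x + y) = f x + f y.
Hypothesis fZ : forall c x, inFq q c -> f (c * x) = c * f x.
Hypothesis fsc : scattered q f.

Lemma scattered_ratio y z :
  y != 0 -> z * f y = y * f z -> exists2 c, inFq q c & z = c * y.
Proof.
move=> y0 /eqP; rewrite -subr_eq0 => /eqP /fsc [l [m [hl [hm [lm E]]]]].
have [m0|m0] := eqVneq m 0.
  move: E lm; rewrite m0 mul0r addr0 => /eqP.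
  by rewrite mulf_eq0 (negPf y0) orbF => /eqP ->; rewrite eqxx => -[].
exists (- (l / m)).
  by have := charq 1; rewrite expn1 /inFq => h; rewrite exprNn_pchar // expr_div_n hl hm.
apply: (mulfI m0); apply/eqP; rewrite -subr_eq0 -E; apply/eqP; field.
by [].
Qed.

(** For such an f the scattered condition applies to 1 and any z, which would put all of [L] in
    F_q. *)
Lemma scattered_nonlinear c : ~ (forall x, f x = c * x).
Proof.
move=> fE; have : (#|[set: L]| <= q)%N.
  apply: (@card_expf_scale_le _ q 1) => // z _; rewrite mul1r.
  have [|e he ->] := @scattered_ratio 1 z (oner_neq0 _).
    by rewrite !fE; ring.
  by rewrite mulr1.
by rewrite cardsT cL -[X in (_ <= X)%N]expn1 leq_exp2l //; lia.
Qed.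

(** It suffices that a linear change of coordinates turns U_f into {(z, phi z)}: F_q-linearity of
    [f] makes [phi] fix F_q, so it is some x^(q^s), and scatteredness forces gcd(s, n) = 1. *)
Lemma pseudoregulusI (a b c d : L) (phi : {rmorphism L -> L}) (z : L -> L) :
  a * d - b * c != 0 -> (forall x, a * x + b * f x = z x) ->
  (forall x, c * x + d * f x = phi (z x)) -> pseudoregulus q n f.
Proof.
move=> D0 zE1 zE2.
have f0 : f 0 = 0 by apply: (addrI (f 0)); rewrite -fD !addr0.
have z_inj : injective z.
  move=> x y xy; suff [] : x = y /\ f x = f y by [].
  by apply: (det2_inj D0); rewrite ?zE1 ?zE2 xy.
have [w wK zK] := injF_bij z_inj.
have z0 : z 0 = 0 by rewrite -zE1 f0; ring.
(* Evaluate at [t * w 1], where [w] inverts [z]: both coordinates are multiplied by t. *)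
have phi_fix t : inFq q t -> phi t = t.
  move=> ht; have <- : z (t * w 1) = t.
    by rewrite -zE1 fZ // mulrCA (mulrCA b) -mulrDr zE1 zK mulr1.
  by rewrite -zE2 -[in RHS]zE1 fZ // !(mulrCA _ t) -!mulrDr zE1 zE2 zK rmorph1.
have [s _ phiE] := rmorph_frobenius pp (ltnW n1) cL phi_fix.
have sn : coprime s n.
  (* Each t in F_(q^e) is fixed by [phi], so the points of U_f over [w t] and [w 1] are proportional
     with ratio t; scatteredness puts t in F_q, whence q^e <= q. *)
  rewrite /coprime; set e := gcdn s n.
  have e0 : (0 < e)%N by rewrite gcdn_gt0 (ltnW n1) orbT.
  have [m nE] := dvdnP (dvdn_gcdr s n : e %| n)%N.
  have [r sE] := dvdnP (dvdn_gcdl s n : e %| s)%N.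
  have cT : #|[set t : L | t ^+ (q ^ e) == t]| = (q ^ e)%N.
    apply: (@card_Fq _ _ m); last by rewrite -expnM mulnC -nE.
      by rewrite -[1%N](exp1n e) ltn_exp2r.
    by rewrite lt0n; apply/eqP => m0; move: n1; rewrite nE m0.
  suff : (#|[set t : L | t ^+ (q ^ e) == t]| <= q)%N.
    by rewrite cT -[X in (_ <= X)%N]expn1 leq_exp2l //; lia.
  apply: (@card_expf_scale_le _ q 1) => // t; rewrite inE mul1r => /eqP te.
  have ts : phi t = t.
    rewrite phiE sE mulnC expnM; elim: (r) => [|r' IH]; first by rewrite expn0 expr1.
    by rewrite expnS exprM te.
  have [E1 E2] : w t = t * w 1 /\ f (w t) = t * f (w 1).
    apply: (det2_inj D0); rewrite ?zE1 ?zE2 zK !(mulrCA _ t) -mulrDr.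
      by rewrite zE1 zK mulr1.
    by rewrite zE2 zK rmorph1 ts mulr1.
  have w10 : w 1 != 0.
    by apply/eqP => w10; have := oner_neq0 L; rewrite -(zK 1) w10 z0 eqxx.
  have [|e' he E3] := @scattered_ratio (w 1) (w t) w10.
    by rewrite E2 E1; ring.
  by move: E3; rewrite E1 => /(mulIf w10) ->.
exists a, b, c, d, s; split=> //; split=> // -[v1 v2] _ /=; split.
  move=> [x [x0 [e [-> ->]]]]; exists (z x); split.
    by rewrite -z0 (inj_eq z_inj).
  by exists e; rewrite -phiE -zE2 -zE1; congr (_, _); ring.
move=> [y [y0 [e [E1 E2]]]]; exists (w y); split.
  by apply/eqP => wy; move: y0; rewrite -(zK y) wy z0 eqxx.
exists e; have [-> ->] // : v1 = e * w y /\ v2 = e * f (w y).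
by apply: (det2_inj D0); rewrite ?E1 ?E2 !(mulrCA _ e) -mulrDr ?zE1 ?zE2 zK ?phiE.
Qed.

Lemma pseudoregulus_of_binomial (a0 a1 : L) i :
  (forall x, f x = a0 * x + a1 * x ^+ (q ^ i)) -> pseudoregulus q n f.
Proof.
move=> fE; have a10 : a1 != 0.
  apply/eqP => a10; apply: (@scattered_nonlinear a0) => x.
  by rewrite fE a10 mul0r addr0.
have [F FE] := exists_frobenius (charq i).
apply: (@pseudoregulusI 1 0 (- (a0 / a1)) a1^-1 F id) => [|x|x].
- by rewrite mul0r subr0 mul1r invr_eq0.
- by ring.
- by rewrite FE fE; field.
Qed.

(** If the determinant [al * de - ga] is nonzero, [g] and its q-th power are the coordinates wanted
    by [pseudoregulusI]. If it vanishes, kernel and image of [g] have at most q elements each,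
    against |L| = q^3. *)
Lemma pseudoregulus_of_trinomial (a0 b c : L) : n = 3 ->
  (forall x, f x = a0 * x + b * x ^+ q + c * x ^+ (q ^ 2)) -> pseudoregulus q n f.
Proof.
move=> n3 fE.
have [b0|b0] := eqVneq b 0.
  by apply: (@pseudoregulus_of_binomial a0 c 2) => x; rewrite fE b0; ring.
have [c0|c0] := eqVneq c 0.
  by apply: (@pseudoregulus_of_binomial a0 b 1) => x; rewrite fE c0 expn1; ring.
have [F FE'] := exists_frobenius (charq 1).
have FE x : F x = x ^+ q by rewrite FE' expn1.
have F3 x : F (F (F x)) = x by rewrite !FE -!exprM -[RHS]expf_card cL n3 !expnS expn0; congr (_ ^+ _); lia.
(* [al] is chosen so that both [g] and its [q]-th power lie in the span of
   [x] and [f x]. *)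
pose al := b * F (F (b / c)); pose de := F b / c; pose ga := F c.
pose g x := al * x + (f x - a0 * x).
have gE x : g x = al * x + b * F x + c * F (F x).
  by rewrite /g fE -mulnn exprM -!FE; ring.
have FgE x : F (g x) = ga * x + de * (f x - a0 * x).
  have -> : f x - a0 * x = b * F x + c * F (F x) by rewrite fE -mulnn exprM -!FE; ring.
  rewrite gE /al /de /ga !(rmorphD, rmorphM) /= !F3.
  by field.
have [det0|D0] := eqVneq (al * de - ga) 0; last first.
  apply: (@pseudoregulusI (al - a0) 1 (ga - a0 * de) de F g) => [|x|x].
  - by apply: contra_neq D0 => D0; rewrite -D0; ring.
  - by rewrite /g; ring.
  - by rewrite FgE; ring.
have {}det0 : ga = al * de by move/eqP: det0; rewrite subr_eq0 => /eqP.
(* All values of [g] solve X^q = de X, so the ratio of two nonzero values lies in F_q. *)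
have Fg x : g x ^+ q = de * g x by rewrite -FE FgE det0 /g; ring.
have gB x y : g (x - y) = g x - g y.
  rewrite /g; have -> : f (x - y) = f x - f y; last by ring.
  by apply/eqP; rewrite eq_sym subr_eq -fD subrK.
have gZ e x : inFq q e -> g (e * x) = e * g x by move=> he; rewrite /g fZ //; ring.
have Fq0 : inFq q (0 : L) by rewrite /inFq expr0n; case: (q) q1.
have [y0 y0P] : exists y0, forall y, g y = 0 -> exists2 e, inFq q e & y = e * y0.
  case: (pickP (fun y => (g y == 0) && (y != 0))) => [y0 /andP[/eqP gy0 y00]|h].
    exists y0 => y gy; apply: scattered_ratio => //.
    (* On the kernel of [g] the map [f] is a multiplication, so scatteredness leaves at most one
       F_q-line. *)
    have kerE u : g u = 0 -> f u = (a0 - al) * u.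
      by move=> gu; have -> : f u = g u - al * u + a0 * u by [rewrite /g; ring]; rewrite gu; ring.
    by rewrite !kerE //; ring.
  exists 0 => y gy; exists 0 => //; rewrite mul0r.
  by have := h y; rewrite gy eqxx /= => /negbT; rewrite negbK => /eqP.
have [x1 x1P] : exists x1, forall x, exists2 e, inFq q e & g (x - e * x1) = 0.
  case: (pickP (fun y => g y != 0)) => [x1 gx1|h].
    exists x1 => x; have he : inFq q (g x / g x1).
      have de0 : de != 0.
        apply/eqP => de0; have := Fg x1; rewrite de0 mul0r => /eqP.
        by rewrite expf_eq0 (negPf gx1) andbF.
      by rewrite /inFq expr_div_n !Fg; field; rewrite gx1 de0.
    by exists (g x / g x1) => //; rewrite gB gZ // divfK // subrr.
  exists 0 => x; exists 0 => //; rewrite mulr0 subr0.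
  by have := h x => /negbT; rewrite negbK => /eqP.
pose K := [set x : L | x ^+ q == x].
have cK : (#|K| <= q)%N.
  by apply: (@card_expf_scale_le _ q 1) => // x; rewrite inE mul1r => /eqP.
have : (#|[set: L]| <= #|K| * #|K|)%N.
  rewrite -cardsX; apply: leq_trans (leq_imset_card (fun u => u.1 * x1 + u.2 * y0) _).
  apply/subset_leq_card/subsetP => x _.
  have [e1 he1 /y0P[e2 he2 E]] := x1P x.
  apply/imsetP; exists (e1, e2); first by rewrite !inE he1 he2 !eqxx.
  by rewrite /= -E addrC subrK.
rewrite cardsT cL n3 => h.
have : (q ^ 3 <= q ^ 2)%N by rewrite -[(q ^ 2)%N]mulnn; apply: leq_trans h (leq_mul cK cK).
by rewrite leq_exp2l.
Qed.

End Scattered.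

Lemma pseudoregulus_low_dim (L : finFieldType) (p k n : nat) (a : 'I_n -> L) :
  prime p -> (1 < p ^ k)%N -> (1 < n < 4)%N -> #|L| = ((p ^ k) ^ n)%N ->
  scattered (p ^ k) (q_polynomial (p ^ k) a) ->
  pseudoregulus (p ^ k) n (q_polynomial (p ^ k) a).
Proof.
move=> pp q1 /andP[n1 n4] cL fsc.
have fD := q_polynomialD pp cL a.
have fZ c x : inFq (p ^ k) c -> q_polynomial (p ^ k) a (c * x) = c * q_polynomial (p ^ k) a x.
  exact: q_polynomialZ.
have [n2|n2] := eqVneq n 2.
  subst n.
  apply: (pseudoregulus_of_binomial pp q1 n1 cL fD fZ fsc
    (a0 := a ord0) (a1 := a ord_max) (i := 1)) => x.
  rewrite /q_polynomial !big_ord_recl big_ord0 addr0 /= expn0 expr1.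
  by congr (_ + a _ * _); apply/val_inj.
have n3 : n = 3 by lia.
subst n.
apply: (pseudoregulus_of_trinomial pp q1 n1 cL fD fZ fsc
  (a0 := a ord0) (b := a (lift ord0 ord0)) (c := a ord_max)) => // x.
rewrite /q_polynomial !big_ord_recl big_ord0 addr0 /= expn0 expr1 expn1 addrA.
by congr (_ + a _ * _); apply/val_inj.
Qed.

(** * Quasifield planes and additivity of isomorphisms onto them *)

Section QuasifieldPlane.
Variables (F : finFieldType) (op : F -> F -> F).
Hypothesis qf : is_quasifield op.

Lemma qf_opD x y z : op (x + y) z = op x z + op y z.
Proof. by case: qf. Qed.

Lemma qf_opB x y z : op (x - y) z = op x z - op y z.
Proof. by apply/eqP; rewrite eq_sym subr_eq -qf_opD subrK. Qed.

Lemma qf_line_unique S1 S2 u v :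
  qf_line op S1 -> qf_line op S2 -> S1 u -> S1 v -> S2 u -> S2 v -> u <> v ->
  forall p, S1 p <-> S2 p.
Proof.
case: qf => _ _ _ _ uniq.
move: u v => [u1 u2] [v1 v2].
case=> [[m [b E1]]|[c E1]] [[m' [b' E2]]|[c' E2]] /E1 /= h1 /E1 /= h2 /E2 /= h3 /E2 /= h4 uv p.
- have [mm|mm] := eqVneq m m'.
    have bb : b = b' by apply: (addrI (op u1 m)); rewrite -h1 h3 mm.
    by rewrite E1 E2 mm bb.
  have [x [_ hx]] := uniq m m' (b' - b) mm.
  have e : u1 = v1.
    transitivity x; [symmetry|]; apply: hx; apply: (addIr b).
      by rewrite -h1 h3 -addrA subrK.
    by rewrite -h2 h4 -addrA subrK.
  by case: uv; rewrite h1 h2 e.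
- by case: uv; rewrite h1 h2 h3 h4.
- by case: uv; rewrite h3 h4 h1 h2.
- by rewrite E1 E2 -h1 -h3.
Qed.

Lemma qf_line_coset S x a b : qf_line op S -> S x -> S a -> S b -> S (x + b - a).
Proof.
case=> [[m [c E]]|[c E]] /E hx /E ha /E hb; apply/E => /=.
  by rewrite hx ha hb qf_opB qf_opD; ring.
by rewrite hx ha hb; ring.
Qed.

(** Disjoint lines have equal slope, since [op x m - op x m'] takes every value when m and m'
    differ. The point [x + b - a] is the fourth corner of a parallelogram. *)
Lemma qf_line_parallel S1 S2 x a b :
  qf_line op S1 -> qf_line op S2 -> ~ (exists p, S1 p /\ S2 p) ->
  S1 x -> S1 a -> S2 b -> S2 (x + b - a).
Proof.
case: qf => _ _ _ _ uniq.
case=> [[m [c E1]]|[c E1]] [[m' [c' E2]]|[c' E2]] dis /E1 hx /E1 ha /E2 hb.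
- have [mm|mm] := eqVneq m m'.
    by apply/E2 => /=; rewrite hx ha hb qf_opB qf_opD mm; ring.
  have [z [hz _]] := uniq m m' (c' - c) mm.
  case: dis; exists (z, op z m + c); rewrite E1 E2 /=; split=> //.
  by rewrite hz -addrA subrK.
- by case: dis; exists (c', op c' m + c); rewrite E1 E2.
- by case: dis; exists (c, op c m' + c'); rewrite E1 E2.
- by apply/E2 => /=; rewrite hx ha hb; ring.
Qed.

Variables (V : zmodType) (comp : (V -> Prop) -> Prop) (sigma : V -> F * F).
Hypothesis sigma_surj : forall y, exists x, sigma x = y.
Hypothesis comp0 : forall W, comp W -> W 0.
Hypothesis compB : forall W, comp W -> forall x y, W x -> W y -> W (x - y).
Hypothesis comp_cover : forall v, exists2 W, comp W & W v.
Hypothesis comp_proper : forall W, comp W -> exists w, ~ W w.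
Hypothesis sigma_line : forall W v, comp W ->
  exists2 S, qf_line op S & forall x, S (sigma x) <-> W (x - v).

Let compN W : comp W -> forall x, W x -> W (- x).
Proof. by move=> cW x Wx; rewrite -sub0r; apply: compB => //; apply: comp0. Qed.

Let compD W : comp W -> forall x y, W x -> W y -> W (x + y).
Proof. by move=> cW x y Wx Wy; rewrite -(opprK y); apply: (compB cW Wx); apply: compN. Qed.

(* [u + v] is the meeting point of the parallel to [v] through [u] and the
   parallel to [u] through [v], and [sigma] preserves parallelism. *)
Let parallelogram W u v S : comp W -> W v -> qf_line op S ->
  (forall x, S (sigma x) <-> W (x - u)) -> S (sigma v + sigma u - sigma 0).
Proof.
move=> cW Wv lS hS; have [S0 lS0 hS0] := sigma_line 0 cW.
have W0 := comp0 cW.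
have S0v : S0 (sigma v) by rewrite hS0 subr0.
have S00 : S0 (sigma 0) by rewrite hS0 subr0.
have Su : S (sigma u) by rewrite hS subrr.
have [[y [S0y Sy]]|dis] := classic (exists y, S0 y /\ S y); last first.
  exact: qf_line_parallel dis _ _ _.
have [z ez] := sigma_surj y; move: S0y Sy; rewrite -ez hS0 hS subr0 => Wz Wzu.
have Wu : W u by have := compB cW Wz Wzu; rewrite subKr.
apply: qf_line_coset => //.
  by apply/hS; apply: compB.
by apply/hS; rewrite sub0r; apply: compN.
Qed.

Let sigmaD_transversal W u v : comp W -> W v -> ~ W u ->
  sigma (u + v) = sigma u + sigma v - sigma 0.
Proof.
move=> cW Wv Wu; have [W' cW' W'u] := comp_cover u.
have [S lS hS] := sigma_line u cW.
have [S' lS' hS'] := sigma_line v cW'.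
have h1 := parallelogram cW Wv lS hS.
have h2 := parallelogram cW' W'u lS' hS'.
(* Both points lie on [S] and on [S']. If they differed, these lines would coincide, which puts [u]
   in [W]. *)
apply: NNPP => ne.
have Suv : S (sigma (u + v)) by rewrite hS addrC addKr.
have S'uv : S' (sigma (u + v)) by rewrite hS' addrK.
rewrite [sigma v + _]addrC in h1.
have E := qf_line_unique lS lS' Suv h1 S'uv h2 ne.
have W'v : W' v.
  have : S (sigma u) by rewrite hS subrr; apply: comp0.
  by rewrite E hS' => /(compB cW' W'u); rewrite subKr.
have : S' (sigma 0) by rewrite hS' sub0r; apply: compN.
by rewrite -E hS sub0r => /(compN cW); rewrite opprK.
Qed.

(** For [u] and [v] on one component, pick [w] off it and expand sigma (w + u + v) in two ways by
    the transversal case. *)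
Lemma collineation_additive u v : sigma (u + v) = sigma u + sigma v - sigma 0.
Proof.
have [W cW Wv] := comp_cover v.
have [Wu|Wu] := classic (W u); last exact: sigmaD_transversal Wv Wu.
have [w Ww] := comp_proper cW.
have Wwu : ~ W (w + u) by move=> /(compB cW) /(_ Wu); rewrite addrK.
have e1 := sigmaD_transversal cW Wv Wwu.
have e2 := sigmaD_transversal cW Wu Ww.
have := sigmaD_transversal cW (compD cW Wu Wv) Ww.
rewrite addrA e1 e2 => E.
apply: (addrI (sigma w)); apply: (addIr (- sigma 0)); rewrite -E !addrA.
by rewrite [_ - sigma 0 + sigma v]addrAC.
Qed.
End QuasifieldPlane.

(** * Scalars on pairs, and maps preserving many lines of a Desarguesian spread *)

Definition scl (R : pzRingType) (c : R) (v : R * R) : R * R := (c * v.1, c * v.2).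

Section Scaling.
Variable R : fieldType.
Implicit Types (a b c : R) (v w : R * R).

Lemma sclA a b v : scl a (scl b v) = scl (a * b) v.
Proof. by rewrite /scl /= !mulrA. Qed.

Lemma scl1 v : scl 1 v = v.
Proof. by case: v => x y; rewrite /scl /= !mul1r. Qed.

Lemma scl0 v : scl 0 v = 0.
Proof. by rewrite /scl !mul0r. Qed.

Lemma sclr0 c : scl c 0 = 0.
Proof. by rewrite /scl !mulr0. Qed.

Lemma sclDr c v w : scl c (v + w) = scl c v + scl c w.
Proof. by rewrite /scl /= !mulrDr. Qed.

Lemma sclDl a b v : scl (a + b) v = scl a v + scl b v.
Proof. by rewrite /scl /= !mulrDl. Qed.

Lemma sclBl a b v : scl (a - b) v = scl a v - scl b v.
Proof. by rewrite /scl /= !mulrBl. Qed.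

Lemma scl_eq0 a v : scl a v = 0 -> a = 0 \/ v = 0.
Proof.
have [->|a0] := eqVneq a 0; first by left.
by move=> E; right; rewrite -(scl1 v) -(mulVf a0) -sclA E sclr0.
Qed.

Lemma sclIl v a b : v <> 0 -> scl a v = scl b v -> a = b.
Proof.
move=> v0 /eqP; rewrite -subr_eq0 -sclBl => /eqP /scl_eq0[] // /eqP.
by rewrite subr_eq0 => /eqP.
Qed.

Lemma scl_indep v w a b a' b' : w <> 0 -> (forall t, v <> scl t w) ->
  scl a v + scl b w = scl a' v + scl b' w -> a = a' /\ b = b'.
Proof.
move=> w0 vw E.
have E1 : scl (a - a') v = scl (b' - b) w.
  rewrite !sclBl; apply/eqP; rewrite subr_eq addrAC -subr_eq opprK.
  by rewrite E addrC.
have aa : a = a'.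
  apply/eqP; rewrite -subr_eq0; apply: contraT => aa; case: (vw ((a - a')^-1 * (b' - b))).
  by rewrite -sclA -E1 sclA mulVf // scl1.
split=> //; move: E1; rewrite aa subrr scl0 => /esym /scl_eq0[] // /eqP.
by rewrite subr_eq0 => /eqP.
Qed.
End Scaling.

(** Three of the lines serve as a frame, on which [rho] acts through one additive function [g1].
    Every further line enlarges the set where [g1] is multiplicative; this set is a subring, and the
    size of [C] makes it all of [F]. *)
Lemma many_scaled_lines_semilinear (F L : finFieldType) (rho : F * F -> L * L) (C : {set F}) :
  #|L| = #|F| -> injective rho -> (forall v w, rho (v + w) = rho v + rho w) ->
  (forall m, m \in C -> forall c, exists t, rho (c, c * m) = scl t (rho (1, m))) ->
  (3 < #|C|)%N -> (#|F| < #|C|.-1 ^ 2)%N ->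
  exists s : {rmorphism F -> L}, forall c v, rho (scl c v) = scl (s c) (rho v).
Proof.
move=> cFL rho_inj rhoD lines C3 cC.
have rho0 : rho 0 = 0 by apply: (addrI (rho 0)); rewrite -rhoD !addr0.
have rho_neq0 v : v <> 0 -> rho v <> 0 by move=> v0; rewrite -rho0 => /rho_inj.
have lineP a m : m \in C -> a != 0 ->
    exists g : F -> L, forall c, rho (scl c (a, a * m)) = scl (g c) (rho (a, a * m)).
  move=> mC a0; have [t ht] := lines m mC a.
  have t0 : t != 0.
    apply/eqP => t0; move: ht; rewrite t0 scl0 -rho0 => /rho_inj [a0' _].
    by rewrite a0' eqxx in a0.
  have rho1 : rho (1, m) = scl t^-1 (rho (a, a * m)) by rewrite ht sclA mulVf // scl1.
  apply: (@fin_all_exists F (fun=> L) (fun c d => rho (scl c (a, a * m)) = scl d (rho (a, a * m)))) => c.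
  have [t' ht'] := lines m mC (c * a).
  by exists (t' * t^-1); rewrite -sclA -rho1 -ht' /scl /= mulrA.
have /card_gt2P[m1 [m2 [m3 [[m1C m2C m3C] [m12 m23 m31]]]]] := ltnW C3.
have d12 : m1 - m2 != 0 by rewrite subr_eq0.
have d32 : m3 - m2 != 0 by rewrite subr_eq0 eq_sym.
have d13 : m1 - m3 != 0 by rewrite subr_eq0 eq_sym.
(* The solution of a + b = 1 and a m1 + b m2 = m3, which puts the sum of [e1] and [e2] on the third
   line. *)
pose a := (m3 - m2) / (m1 - m2); pose b := (m1 - m3) / (m1 - m2).
have a0 : a != 0 by rewrite mulf_neq0 ?invr_eq0.
have b0 : b != 0 by rewrite mulf_neq0 ?invr_eq0.
pose e1 := (a, a * m1); pose e2 := (b, b * m2).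
have e12 : e1 + e2 = (1, 1 * m3).
  by rewrite /e1 /e2 /a /b; congr (_, _) => /=; field.
have [g1 hg1] := lineP a m1 m1C a0.
have [g2 hg2] := lineP b m2 m2C b0.
have [g3 hg3] := lineP 1 m3 m3C (oner_neq0 _).
rewrite -/e1 in hg1; rewrite -/e2 in hg2; rewrite -e12 in hg3.
have e20 : e2 <> 0 by move=> /(congr1 fst) /= /eqP; rewrite (negPf b0).
have e10 : e1 <> 0 by move=> /(congr1 fst) /= /eqP; rewrite (negPf a0).
have g2_inj : injective g2.
  by move=> c d E; apply: (sclIl e20); apply: rho_inj; rewrite !hg2 E.
have [g2' g2K g2K'] : bijective g2 by apply: inj_card_bij => //; rewrite cFL.
(* As [g2] is onto, a multiple of [rho e2] is the image of a multiple of [e2]. *)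
have e12_indep t : rho e1 <> scl t (rho e2).
  rewrite -(g2K' t) -hg2 => /rho_inj [E1 E2]; case/negP: m12; apply/eqP.
  by apply: (mulfI a0); rewrite E2 E1 mulrA.
have indep := scl_indep (rho_neq0 _ e20) e12_indep.
(* Compare coefficients in the image of c (e1 + e2), where [g3] acts on both summands. *)
have g13 c : g1 c = g2 c.
  have [-> ->//] : g1 c = g3 c /\ g2 c = g3 c.
  by apply: indep; rewrite -sclDr -hg1 -hg2 -rhoD -sclDr -[in RHS]rhoD hg3.
have rhoE x y : rho (scl x e1 + scl y e2) = scl (g1 x) (rho e1) + scl (g1 y) (rho e2).
  by rewrite rhoD hg1 hg2 -g13.
have r10 := rho_neq0 _ e10; have r20 := rho_neq0 _ e20.
have sD x y : g1 (x + y) = g1 x + g1 y.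
  by apply: (sclIl r10); rewrite sclDl -!hg1 -rhoD -sclDl.
have s1 : g1 1 = 1 by apply: (sclIl r10); rewrite -hg1 !scl1.
have sB : zmod_morphism g1.
  by move=> x y; apply/eqP; rewrite eq_sym subr_eq -sD subrK.
have decomp v : v = scl ((v.2 - m2 * v.1) / (m3 - m2)) e1
                    + scl ((m1 * v.1 - v.2) / (m1 - m3)) e2.
  case: v => x y; rewrite /scl /e1 /e2 /a /b /=; congr (_, _) => /=; field.
    by rewrite d12 d32 d13.
  by rewrite d12 d32 d13.
(* With three common lines as axes and diagonal, [g1] is multiplicative on the
   slope of every further common line. *)
pose K := [set l : F | [forall c, g1 (c * l) == g1 c * g1 l]].
have KP l : reflect (forall c, g1 (c * l) = g1 c * g1 l) (l \in K).
  by rewrite inE; apply: (iffP forallP) => h c; apply/eqP.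
(* [e1 + slope m e2] lies on the line of m. For [m2] the slope is infinite, hence [C :\ m2] and the
   bound [#|C|.-1]; as a fractional linear map [slope] is injective. *)
pose slope m := (m1 - m) * (m3 - m2) / ((m1 - m3) * (m - m2)).
have sub : [set slope m | m in C :\ m2] \subset K.
  apply/subsetP => _ /imsetP[m /setD1P[mm mC] ->]; apply/KP => c.
  have dm : m - m2 != 0 by rewrite subr_eq0.
  pose x := (m3 - m2) / (m - m2).
  have x0 : x != 0 by rewrite mulf_neq0 ?invr_eq0.
  have [g hg] := lineP x m mC x0.
  have E : (x, x * m) = scl 1 e1 + scl (slope m) e2.
    rewrite [LHS]decomp; congr (scl _ _ + scl _ _); rewrite /= /x /slope; field.
      by rewrite d32 dm.
    by rewrite d13 dm.
  have := hg c; rewrite E sclDr !sclA mulr1 !rhoE sclDr !sclA s1 mulr1.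
  by case/indep => -> ->.
have cK : (#|C|.-1 <= #|K|)%N.
  apply: leq_trans (subset_leq_card sub).
  rewrite card_in_imset; first by rewrite (cardsD1 m2 C) m2C.
  move=> m m' /setD1P[mm _] /setD1P[mm' _]; rewrite /slope.
  have dm : m - m2 != 0 by rewrite subr_eq0.
  have dm' : m' - m2 != 0 by rewrite subr_eq0.
  move=> /eqP; rewrite eqr_div ?mulf_neq0 // -subr_eq0 => /eqP E.
  have : (m - m') * ((m1 - m2) * (m3 - m2) * (m1 - m3)) = 0.
    by rewrite -[RHS]oppr0 -E; ring.
  move/eqP; rewrite mulf_eq0 !mulf_eq0 (negPf d12) (negPf d13) (negPf d32) !orbF.
  by rewrite subr_eq0 => /eqP.
have allK : forall l, l \in K.
  apply: subring_full.
  - by apply/KP => c; rewrite s1 !mulr1.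
  - by move=> x y /KP hx /KP hy; apply/KP => c; rewrite mulrBr !sB hx hy mulrBr.
  - by move=> x y /KP hx /KP hy; apply/KP => c; rewrite mulrA !hy hx mulrA.
  - by apply: leq_trans cC _; rewrite leq_exp2r.
have sM : monoid_morphism g1 by split=> // x y; have /KP := allK y.
pose sDM := GRing.isZmodMorphism.Build F L g1 sB.
pose sMM := GRing.isMonoidMorphism.Build F L g1 sM.
exists (HB.pack g1 sDM sMM : {rmorphism F -> L}) => c v /=.
by rewrite (decomp v) sclDr !sclA !rhoE sclDr !sclA -!sM.2.
Qed.

(** * Counting: a large class under few automorphisms *)

Lemma pigeonhole (T I : finType) (A : {set T}) (g : T -> I) (i0 : I) :
  exists i, (#|A| <= #|I| * #|[set x in A | g x == i]|)%N.
Proof.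
pose c i := #|[set x in A | g x == i]|.
have [i _ hi] := @arg_maxnP I i0 xpredT c isT; exists i.
rewrite -/(c i) -sum_nat_const -sum1_card (partition_big g xpredT) //=.
apply: leq_sum => j _; apply: leq_trans (hi j isT).
by rewrite /c sum1dep_card; apply/subset_leq_card/subsetP => x; rewrite !inE.
Qed.

(** The induction starts at 8, where 26^2 = 676 < 1024; at 7 the inequality fails. *)
Lemma square_lt_expn2 N : (8 <= N)%N -> ((3 * N + 2) ^ 2 < 4 * 2 ^ N)%N.
Proof.
move=> /subnK <-; elim: (N - 8)%N => [//|m IH].
rewrite addSn (expnS 2); move: (2 ^ (m + 8))%N IH => X; rewrite -!mulnn => IH.
have e1 : (3 * (m + 8) + 2 = 3 * m + 26)%N by lia.
have -> : (3 * (m + 8).+1 + 2 = 3 * m + 26 + 3)%N by lia.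
have : (26 <= 3 * m + 26)%N by rewrite leq_addl.
rewrite e1 in IH; move: (3 * m + 26)%N IH => a IH a26.
have : (26 * a <= a * a)%N by rewrite leq_mul2r a26 orbT.
by rewrite !mulnDl !mulnDr; lia.
Qed.

(** [Q] is the field order, [N] the number of possible automorphisms, [B] and [G] count bad and good
    m, [c] is the size of the largest class. Then c is at least 2(Q - 1)/(3N), and N <= log_2 Q
    makes this exceed 1 + sqrt Q. *)
Lemma large_class (Q N B G c : nat) :
  (256 <= Q)%N -> (2 ^ N <= Q)%N -> (3 * B <= Q.-1)%N -> (B + G = Q.-1)%N ->
  (G <= N * c)%N -> (Q < c.-1 ^ 2)%N.
Proof.
move=> Q256 NQ hB hG hc.
have hN : ((3 * N + 2) ^ 2 < 4 * Q)%N.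
  have [N8|N8] := leqP 8 N.
    by apply: leq_trans (square_lt_expn2 N8) _; rewrite leq_mul2l NQ.
  by rewrite -mulnn; nia.
rewrite ltnNge; apply/negP; rewrite -mulnn => ht.
have hac : (2 * Q - 2 <= 3 * N * c.-1.+1)%N.
  apply: (@leq_trans (3 * (N * c))); first by lia.
  by rewrite mulnA leq_mul2l; apply/orP; right; lia.
move: hN ht hac; rewrite -mulnn; move: (3 * N)%N c.-1 => x t h1 h2 h3.
(* Here x = 3N and t = c - 1. For small t the bound on x (t + 1) contradicts (x + 2)^2 < 4Q; for
   large t, x <= 2t - 3 contradicts t^2 <= Q. *)
have [h|h] := leqP (2 * t) (x + 2).
  have : (x * (2 * t + 2) <= x * (x + 4))%N by rewrite leq_mul2l; apply/orP; right; lia.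
  by nia.
have : (x * t.+1 <= (2 * t - 3) * t.+1)%N by rewrite leq_mul2r; apply/orP; right; lia.
by nia.
Qed.

(** * From isomorphic planes to an additive map between spreads *)

Definition andre_comp (F : finFieldType) (op : F -> F -> F) (A : F * F -> Prop) : Prop :=
  (exists m, forall p, A p <-> p.2 = op p.1 m) \/ (forall p, A p <-> p.1 = 0).

Section Linearization.
Variables (L F : finFieldType) (f : L -> L) (op : F -> F -> F).
Hypothesis fD : forall x y, f (x + y) = f x + f y.
Hypothesis qf : is_quasifield op.

Let f0 : f 0 = 0.
Proof. by apply: (addrI (f 0)); rewrite -fD !addr0. Qed.

Let fB x y : f (x - y) = f x - f y.
Proof. by apply/eqP; rewrite eq_sym subr_eq -fD subrK. Qed.

Lemma in_Bf0 W : in_Bf f W -> W 0.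
Proof.
case=> [[u [_ [_ hW]]]|[h [_ hW]]]; apply/hW; exists 0; first by rewrite !mul0r.
by rewrite f0 !mulr0.
Qed.

Lemma in_BfB W : in_Bf f W -> forall v w, W v -> W w -> W (v - w).
Proof.
case=> [[u [_ [_ hW]]]|[h [_ hW]]] v w /hW[c ->] /hW[d ->]; apply/hW; exists (c - d).
  by rewrite !mulrBl.
by rewrite fB !mulrBr.
Qed.

Lemma in_Bf_cover v : exists2 W, in_Bf f W & W v.
Proof.
have [[x [x0 [c ->]]]|nLf] := classic (in_Lf f v).
  (* The multiplier of U_f must be nonzero; if c = 0 then v = 0 lies on every component. *)
  pose c' := if c == 0 then 1 else c.
  exists (fun w => exists x : L, w = (c' * x, c' * f x)).
    by right; exists c'; split=> //; rewrite /c'; case: (eqVneq c 0); rewrite ?oner_eq0.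
  rewrite /c'; case: eqP => [->|_]; last by exists x.
  by exists 0; rewrite f0 !mulr0 !mul0r.
have [->|v0] := eqVneq v 0.
  exists (fun w => exists x : L, w = (1 * x, 1 * f x)); last by exists 0; rewrite f0 mulr0.
  by right; exists 1; split=> //; apply: oner_neq0.
exists (fun w => exists c, w = (c * v.1, c * v.2)).
  by left; exists v.
by exists 1; rewrite !mul1r; case: (v).
Qed.

Lemma in_Bf_proper W : in_Bf f W -> exists w, ~ W w.
Proof.
case=> [[[u1 u2] [u0 [_ hW]]]|[h [h0 hW]]]; last first.
  exists (h, h * f 1 + 1) => /hW [x [/esym /eqP]].
  rewrite -subr_eq0 -{2}(mulr1 h) -mulrBr mulf_eq0 (negPf h0) subr_eq0 /= => /eqP ->.
  by move/eqP; rewrite -subr_eq0 addrC addKr oner_eq0.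
have [u10|u10] := eqVneq u1 0.
  exists (1, 0) => /hW [c [/eqP]]; rewrite /= u10 mulr0.
  by rewrite oner_eq0.
exists (0, 1) => /hW [c [/esym/eqP]]; rewrite /= mulf_eq0 (negPf u10) orbF => /eqP ->.
by move/eqP; rewrite mul0r oner_eq0.
Qed.

(** Subtracting the image of 0 makes the isomorphism additive; components are then the lines through
    the origin on both sides. *)
Lemma andre_linearization :
  iso_planes (Af_line f) (qf_line op) ->
  exists tau : L * L -> F * F,
    [/\ bijective tau, forall v w, tau (v + w) = tau v + tau w,
        forall A, andre_comp op A ->
          exists2 W, in_Bf f W & forall v, W v <-> A (tau v)
      & forall W, in_Bf f W ->
          exists2 A, andre_comp op A & forall v, W v <-> A (tau v)].
Proof.
move=> [sigma [sbij lines]].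
have [sigma' sK sK'] := sbij; have s_inj := can_inj sK.
have s_surj y : exists x, sigma x = y by exists (sigma' y).
have s_line W v : in_Bf f W ->
    exists2 S, qf_line op S & forall x, S (sigma x) <-> W (x - v).
  move=> hW; exists (fun y => exists x, W (x - v) /\ sigma x = y).
    apply/lines; exists v, W; split=> // x; split=> [Wx|[w [Ww ->]]].
      by exists (x - v); split=> //; change (x = v + (x - v)); rewrite addrC subrK.
    by change (W (v + w - v)); rewrite addrC addKr.
  by move=> x; split=> [[x' [Wx' /s_inj <-]]|Wx] //; exists x.
have sD := collineation_additive qf s_surj in_Bf0 in_BfB in_Bf_cover in_Bf_proper s_line.
have opB := qf_opB qf; have opD := qf_opD qf.
have op0 m : op 0 m = 0 by have := opB 0 0 m; rewrite !subrr.
exists (fun v => sigma v - sigma 0); split.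
- exists (fun y => sigma' (y + sigma 0)) => x; first by rewrite subrK sK.
  by rewrite sK' addrK.
- by move=> v w; rewrite sD -addrA [RHS]addrACA.
- move=> A hA; pose S v := A (sigma v - sigma 0).
  have A0 : A 0 by case: hA => [[m E]|E]; apply/E; rewrite ?op0.
  have /lines [v0 [W [hW E]]] : qf_line op (fun y => exists x, S x /\ sigma x = y).
    have ext y : (exists x, S x /\ sigma x = y) <-> A (y - sigma 0).
      by split=> [[x [Sx <-]]|Ay] //; exists (sigma' y); rewrite /S sK'.
    case: hA => [[m hA]|hA]; [left|right].
      exists m, ((sigma 0).2 - op (sigma 0).1 m) => y; rewrite ext hA /= opB.
      split=> [h|->]; last by ring.
      by rewrite -[y.2](subrK (sigma 0).2) h; ring.
    exists (sigma 0).1 => y; rewrite ext hA /=.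
    by split=> [/eqP|->]; rewrite ?subrr // subr_eq0 => /eqP.
  exists W => // v.
  have ES x : S x <-> W (x - v0).
    split=> [/E[w [Ww ->]]|Wx].
      by change (W (v0 + w - v0)); rewrite addrC addKr.
    by apply/E; exists (x - v0); split=> //; change (x = v0 + (x - v0)); rewrite addrC subrK.
  (* The preimage of [A] is a coset v0 + W containing 0, hence [W] itself. *)
  have Wv0 : W v0.
    have : S 0 by rewrite /S subrr.
    move=> /ES; rewrite sub0r => h.
    by rewrite -[v0]opprK -[- - v0]sub0r; exact: (in_BfB hW (in_Bf0 hW) h).
  rewrite -/(S v) ES; split=> [Wv|Wv]; first exact: in_BfB.
  rewrite -(subrK v0 v) -[v in _ + v]opprK.
  apply: (in_BfB hW Wv); rewrite -sub0r.
  exact: (in_BfB hW (in_Bf0 hW) Wv0).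
- move=> W hW; have [S lS hS] := s_line W 0 hW.
  exists (fun p => S (p + sigma 0)); last by move=> v; rewrite subrK hS subr0.
  have S0 : S (sigma 0) by rewrite hS subrr; apply: in_Bf0.
  case: lS => [[m [b E]]|[c E]]; move/E: S0 => e0.
    left; exists m => y; rewrite E /= opD e0.
    by split=> [h|->]; [apply: (addIr (op (sigma 0).1 m + b)); rewrite h|]; ring.
  right=> y; rewrite E /= e0; split=> [h|->]; last by rewrite add0r.
  by apply: (addIr c); rewrite h add0r.
Qed.
End Linearization.


(** * Good and bad components, and the shape of U_f *)

Section NotAndre.
Variables (L F : finFieldType) (p k n : nat) (f : L -> L) (lam : F -> F -> F).
Let q := (p ^ k)%N.
Hypotheses (pp : prime p) (q3 : (3 < q)%N) (n3 : (3 < n)%N).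
Hypothesis cL : #|L| = (q ^ n)%N.
Hypothesis fD : forall x y, f (x + y) = f x + f y.
Hypothesis fZ : forall c x, inFq q c -> f (c * x) = c * f x.
Hypothesis fsc : scattered q f.
Hypothesis gas : gas_map lam.

Variable tau : L * L -> F * F.
Hypothesis tau_bij : bijective tau.
Hypothesis tauD : forall v w, tau (v + w) = tau v + tau w.
Hypothesis tau_pre : forall A, andre_comp (gas_op lam) A ->
  exists2 W, in_Bf f W & forall v, W v <-> A (tau v).
Hypothesis tau_img : forall W, in_Bf f W ->
  exists2 A, andre_comp (gas_op lam) A & forall v, W v <-> A (tau v).

Let q1 : (1 < q)%N. Proof. exact: ltnW (ltnW q3). Qed.
Let n1 : (1 < n)%N. Proof. exact: ltnW (ltnW n3). Qed.

Let N := (k * n)%N.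

Lemma card_F : #|F| = #|L|.
Proof.
have := bij_eq_card tau_bij; rewrite !card_prod !mulnn => /eqP.
by rewrite eqn_exp2r // => /eqP.
Qed.

(** Written over the prime field, as a base p^k with k = 1, to suit [rmorph_frobenius]. *)
Let cF : #|F| = ((p ^ 1) ^ N)%N.
Proof. by rewrite card_F cL expn1 expnM. Qed.

Let N_gt0 : (0 < N)%N.
Proof.
by rewrite muln_gt0 (ltnW n1) andbT lt0n; apply/eqP => k0; move: q1; rewrite /q k0.
Qed.

Let charF i : [pchar F].-nat (p ^ i)%N.
Proof. by have := pchar_nat_expn i pp cF; rewrite expn1. Qed.

(** An automorphism fixes the prime field, so it is a power of the Frobenius; λ thus takes at most N
    = log_p |F| values. *)
Lemma lam_frobenius m : m != 0 -> exists j : 'I_N, forall x, lam m x = x ^+ (p ^ j).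
Proof.
move=> m0; have [lD lM l1 _] := gas.1 m m0.
have lB : zmod_morphism (lam m).
  by move=> x y; apply/eqP; rewrite eq_sym subr_eq -lD subrK.
have lMM : monoid_morphism (lam m) by [].
pose lDM := GRing.isZmodMorphism.Build F F (lam m) lB.
pose lMM' := GRing.isMonoidMorphism.Build F F (lam m) lMM.
pose l : {rmorphism F -> F} := HB.pack (lam m) lDM lMM'.
have pF : p \in [pchar F] by apply: card_finPcharP pp; rewrite cF expn1.
have [x|s sN sE] := @rmorph_frobenius F p 1 N l pp N_gt0 cF.
  by rewrite expn1 => /(prime_subfield pF) [e ->]; rewrite rmorph_nat.
by exists (Ordinal sN) => x; rewrite -[lam m x]/(l x) sE expn1.
Qed.

(** For nonzero h and m these are membership in hU_f and in V(m), in boolean form so that [bad], the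
    m whose V(m) comes from some hU_f, is a finite set. *)
Let on_graph (h : L) (v : L * L) := v.2 == h * f (v.1 / h).
Let on_andre (m : F) (w : F * F) := w.2 == lam m w.1 * m.
Let bad := [set m : F | (m != 0) &&
  [exists h, (h != 0) && [forall v, on_graph h v == on_andre m (tau v)]]].

(** F_q-linearity gives chU_f = hU_f for nonzero c in F_q, so each bad m uses up q - 1 multipliers
    h, and distinct m use disjoint sets of them. The factor 3 is q - 1 >= 3. *)
Lemma card_bad : (3 * #|bad| <= #|F|.-1)%N.
Proof.
have /fin_all_exists [h hP] : forall m, exists h, m \in bad ->
    h != 0 /\ forall v, on_graph h v = on_andre m (tau v).
  move=> m; have [|_] := boolP (m \in bad); last by exists 0.
  rewrite inE => /andP[_ /existsP[h /andP[h0 /forallP hE]]]; exists h => _.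
  by split=> // v; exact: eqP (hE v).
pose K := [set x : L | x ^+ q == x] :\ 0.
have cK : #|K| = q.-1.
  have q0 : (q == 0)%N = false by rewrite -leqn0 leqNgt (ltnW q1).
  have := cardsD1 0 [set x : L | x ^+ q == x].
  by rewrite -/K (card_Fq q1 (ltnW n1) cL) inE expr0n q0 eqxx => ->.
apply: (@leq_trans (#|K| * #|bad|)); first by rewrite leq_mul2r cK; apply/orP; right; lia.
rewrite -cardsX card_F -(cardC1 0) -[X in (_ <= X)%N]cardsE.
pose g (u : L * F) := u.1 * h u.2.
have gE c m : c \in K -> m \in bad -> forall v, on_graph (c * h m) v = on_andre m (tau v).
  move=> /setD1P[c0]; rewrite inE => /eqP cq mb v; have [h0 <-] := hP m mb.
  rewrite /on_graph; congr (_ == _).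
  have -> : v.1 / (c * h m) = c^-1 * (v.1 / h m) by field; rewrite c0 h0.
  rewrite (@fZ c^-1); last by rewrite /inFq exprVn cq.
  by field.
rewrite -(@card_in_imset _ _ g).
  apply/subset_leq_card/subsetP => _ /imsetP[[c m] /setXP[/= cK' mb] ->].
  have [h0 _] := hP m mb; rewrite inE /g /= inE /= mulf_neq0 //.
  by case/setD1P: cK'.
move=> [c m] [c' m'] /setXP[/= cK1 mb] /setXP[/= cK2 mb'] E.
have [t tK tK'] := tau_bij.
have mm : m = m'.
  have l1 x : x \in bad -> lam x 1 = 1.
    by rewrite inE => /andP[x0 _]; have [] := gas.1 x x0.
  (* The point (1, m) lies on V(m), hence on V(m'), where the second coordinate over 1 is m'. *)
  have := gE _ _ cK1 mb (t (1, m)); rewrite -[c * _]/(g (c, m)) E (gE _ _ cK2 mb').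
  by rewrite tK' /on_andre /= !l1 // !mul1r eqxx => /eqP.
rewrite mm in E *; congr (_, _); move: E; rewrite /g /=.
by apply: mulIf; have [] := hP m' mb'.
Qed.

Lemma good_line m : m != 0 -> m \notin bad ->
  exists2 u, u != 0 & forall v, on_andre m (tau v) <-> exists c, v = scl c u.
Proof.
move=> m0 mb.
have [|W [[u [u0 [_ hW]]]|[h [h0 hW]]] hA] := @tau_pre (on_andre m).
- left; exists m => w; rewrite /on_andre /gas_op (negPf m0).
  by split=> [/eqP|->].
- by exists u => // v; rewrite -hA hW.
case/negP: mb; rewrite inE m0; apply/existsP; exists h; rewrite h0.
apply/forallP => v; apply/eqP; apply/idP/idP => [/eqP gv|av].
  apply/hA/hW; exists (v.1 / h); rewrite -gv mulrC divfK //.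
  by case: (v).
have /hA/hW [x ->] := av; rewrite /on_graph /=.
by rewrite [h * x]mulrC mulfK.
Qed.

Lemma large_frobenius_class :
  exists (j : 'I_N) (C : {set F}), [/\ (3 < #|C|)%N, (#|F| < #|C|.-1 ^ 2)%N &
    forall m, m \in C -> [/\ m != 0, m \notin bad & forall x, lam m x = x ^+ (p ^ j)]].
Proof.
have /fin_all_exists [g gP] : forall m, exists j : 'I_N,
    m != 0 -> forall x, lam m x = x ^+ (p ^ j).
  move=> m; have [->|/lam_frobenius [j hj]] := eqVneq m 0; last by exists j.
  by exists (Ordinal N_gt0).
pose G := [set m : F | (m != 0) && (m \notin bad)].
have [j hj] := pigeonhole G g (Ordinal N_gt0).
exists j, [set m in G | g m == j].
(* 256 = 4^4, from q >= 4 and n >= 4. *)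
have F256 : (256 <= #|F|)%N.
  rewrite card_F cL; apply: (@leq_trans (4 ^ n)); last by rewrite leq_exp2r // (ltnW n1).
  exact: (@leq_pexp2l 4 4 n).
have cG : (#|bad| + #|G| = #|F|.-1)%N.
  rewrite -(cardC1 0) -[RHS]cardsE -cardsUI.
  have -> : bad :&: G = set0.
    apply/setP => m; rewrite in_setI [m \in G]inE in_set0.
    by case: (m \in bad); rewrite ?andbF.
  rewrite cards0 addn0; apply: eq_card => m; rewrite in_setU [m \in G]inE [RHS]inE -[RHS]/(m != 0).
  have badN0 : m \in bad -> m != 0 by rewrite inE => /andP[].
  by case: (m \in bad) badN0 => [/(_ isT)->|_]; rewrite ?andbT.
have N2 : (2 ^ N <= #|F|)%N by rewrite cF expn1 leq_exp2r // prime_gt1.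
rewrite card_ord in hj.
have big := large_class F256 N2 card_bad cG hj.
split=> // [|m]; last first.
  by rewrite !inE => /andP[/andP[m0 mb] /eqP <-]; split=> //; apply: gP.
move: big F256; set c := #|_|; case: (ltnP 3 c) => // c3 h1 h2.
have : (c.-1 ^ 2 <= 4)%N by rewrite -[4%N]/(2 ^ 2)%N leq_exp2r //; lia.
by move=> h3; have := leq_trans h1 h3; lia.
Qed.

Lemma pseudoregulus_of_andre : pseudoregulus q n f.
Proof.
have [j [C [C3 cC CP]]] := large_frobenius_class.
have [t tK tK'] := tau_bij.
have t_inj : injective t := can_inj tK'.
have tD v w : t (v + w) = t v + t w by apply: (can_inj tK); rewrite tauD !tK'.
have tau0 : tau 0 = 0 by apply: (addrI (tau 0)); rewrite -tauD !addr0.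
have [Fi FiE] := exists_frobenius (charF j).
have [Fj FjE] := exists_frobenius (charF (N - j)).
have FijK x : Fi (Fj x) = x.
  rewrite FiE FjE -exprM -expnD subnK; last exact: ltnW.
  by rewrite -[RHS]expf_card cF expn1.
have FjiK x : Fj (Fi x) = x by apply: (fmorph_inj Fi); rewrite FijK.
(* Undoing the common automorphism on the first coordinate straightens each V(m), m in [C], to the
   line y = x m. *)
pose rho (w : F * F) := t (Fj w.1, w.2).
have rho_inj : injective rho.
  by move=> [x y] [x' y'] /t_inj [/(fmorph_inj Fj) -> ->].
have rhoD v w : rho (v + w) = rho v + rho w by rewrite /rho rmorphD -tD.
have rho0 : rho 0 = 0 by apply: (addrI (rho 0)); rewrite -rhoD !addr0.
have rho_lines m : m \in C -> forall c, exists e, rho (c, c * m) = scl e (rho (1, m)).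
  move=> /CP [m0 mb lamE] c; have [u u0 uP] := good_line m0 mb.
  have onm x : exists e, rho (x, x * m) = scl e u.
    by apply/uP; rewrite /rho tK' /on_andre /= lamE -FiE FijK.
  have [e1 E1] := onm 1; have [e E] := onm c.
  rewrite mul1r in E1; have e10 : e1 != 0.
    apply/eqP => e10; move: E1; rewrite e10 scl0 -rho0 => /rho_inj [/eqP].
    by rewrite oner_eq0.
  by exists (e / e1); rewrite E E1 sclA divfK.
have [s sP] := many_scaled_lines_semilinear (esym card_F) rho_inj rhoD rho_lines C3 cC.
pose P := rho (1, 0); pose R := rho (0, 1).
have rhoE x y : rho (x, y) = scl (s x) P + scl (s y) R.
  by rewrite -!sP -rhoD; congr rho; rewrite /scl /=; congr (_, _) => /=; ring.
have not_line u : ~ (forall x, exists e, (x, f x) = scl e u).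
  move=> h; have [e1 [E1 E2]] := h 1.
  apply: (@scattered_nonlinear L p k n pp q1 n1 cL f fsc (u.2 / u.1)) => x.
  have u10 : u.1 != 0 by apply/eqP => u10; move/eqP: E1; rewrite u10 mulr0 oner_eq0.
  by have [e [-> ->]] := h x; field.
have [|A hA hU] := @tau_img (fun v => exists x, v = (1 * x, 1 * f x)).
  by right; exists 1; split=> //; apply: oner_neq0.
have Ugraph x : A (tau (x, f x)) by apply/hU; exists x; rewrite !mul1r.
have tauE v : v = rho (Fi (tau v).1, (tau v).2).
  by rewrite /rho FjiK -[LHS]tK; case: (tau v).
(* The axes x = 0 and y = 0 correspond to the spans of [R] and [P], which cannot contain U_f; so U_f
   is a V(m) with m nonzero. *)
case: hA => [[m hA]|hA]; last first.
  case: (not_line R) => x; exists (s (tau (x, f x)).2).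
  by rewrite [LHS]tauE rhoE (proj1 (hA _) (Ugraph x)) !rmorph0 scl0 add0r.
have [m0|m0] := eqVneq m 0.
  case: (not_line P) => x; exists (s (Fi (tau (x, f x)).1)).
  rewrite [LHS]tauE rhoE (proj1 (hA _) (Ugraph x)) /gas_op m0 eqxx.
  by rewrite rmorph0 scl0 addr0.
have [j' lamE] := lam_frobenius m0.
(* In straightened coordinates, N - j further Frobenius steps undo the p^j-th power, and then λ(m)
   acts as the p^j'-th power. *)
have charL : [pchar L].-nat (p ^ (N - j + j'))%N.
  by have := @pchar_nat_expn L p 1 N (N - j + j') pp; rewrite expn1 -card_F cF expn1; apply.
have [phi phiE] := exists_frobenius charL.
pose z x := s (Fi (tau (x, f x)).1).
pose R' := scl (s m) R.
have graphE x : (x, f x) = scl (z x) P + scl (phi (z x)) R'.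
  rewrite [LHS]tauE rhoE; congr (_ + _); rewrite (proj1 (hA _) (Ugraph x)).
  rewrite /gas_op (negPf m0) rmorphM -sclA; congr (scl _ _).
  by rewrite lamE phiE /z -rmorphXn expnD exprM -FjE FjiK.
have [s' sK sK'] : bijective s.
  by apply: inj_card_bij; [apply: fmorph_inj | rewrite card_F].
have indep a b : scl a P = scl b R' -> a = 0.
  rewrite /R' sclA -(sK' a) -(sK' b) -rmorphM -!sP => /rho_inj [/eqP].
  by rewrite mulr1 mulr0 => /eqP -> _; rewrite rmorph0.
have R'0 : R' != 0.
  apply/eqP => /scl_eq0 [/eqP|]; first by rewrite fmorph_eq0 (negPf m0).
  by rewrite -rho0 => /rho_inj [/eqP]; rewrite oner_eq0.
clearbody R'.
(* By Cramer's rule in the basis [P], [R'], the coordinates z x and phi (z x) are linear in x and f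
   x. *)
pose D := P.1 * R'.2 - P.2 * R'.1.
have D0 : D != 0.
  apply/eqP => D0; have E : P.1 * R'.2 = P.2 * R'.1 by apply/eqP; rewrite -subr_eq0 -/D D0.
  case/eqP: R'0; apply: injective_projections => /=.
    by apply: (indep _ P.1); rewrite /scl; congr (_, _); rewrite ?E mulrC // mulrC E mulrC.
  by apply: (indep _ P.2); rewrite /scl; congr (_, _); rewrite mulrC ?E.
apply: (@pseudoregulusI L p k n pp q1 n1 cL f fD fZ fsc
  (R'.2 / D) (- R'.1 / D) (- P.2 / D) (P.1 / D) phi z) => [|x|x].
- have -> : R'.2 / D * (P.1 / D) - - R'.1 / D * (- P.2 / D) = D^-1.
    by rewrite /D; field.
  by rewrite invr_eq0.
- have [E1 E2] := graphE x; rewrite [in LHS]E2 {1}E1 /D.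
  by field.
- have [E1 E2] := graphE x; rewrite [in LHS]E2 {1}E1 /D.
  by field.
Qed.
End NotAndre.

Theorem theorem5p9 (L : finFieldType) (q n : nat) (a : 'I_n -> L) :
  (exists p k : nat, prime p /\ q = (p ^ k)%N) ->
  (1 < n)%N -> (3 < q)%N -> #|L| = (q ^ n)%N ->
  scattered q (q_polynomial q a) ->
  ~ pseudoregulus q n (q_polynomial q a) ->
  ~ gen_andre_plane (Af_line (q_polynomial q a)).
Proof.
move=> [p [k [pp ->]]] n1 q3 cL sc nps [F [lam [gas [qf iso]]]]; apply: nps.
have q1 : (1 < p ^ k)%N by apply: ltnW (ltnW q3).
have [n4|n4] := ltnP n 4; first by apply: pseudoregulus_low_dim; rewrite ?n1.
have fD := q_polynomialD pp cL a.
have [tau [tb tD pre img]] := andre_linearization fD qf iso.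
apply: (pseudoregulus_of_andre pp q3 n4 cL fD _ sc gas tb tD pre img) => c x.
exact: q_polynomialZ.
Qed.
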